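(* The Gegenbauer filtration $\mathcal{G}_n(r)$ is the limit of a sequence of finite linear combinations of the hyperspherical Legendre harmonics.
   Context: Let $n\ge 3$ be an integer and $|r|<1$. $S^{n-1}=\{x\in\mathbb{R}^n: x^Tx=1\}$ is the unit hypersphere, $dS_{n-1}$ is its surface element, and $|S^{n-1}|=\int_{S^{n-1}}dS_{n-1}$ is its surface area (likewise $|S^{n-2}|$ for $S^{n-2}$). The Gegenbauer filtration kernel is $$G_n(r,t)=\frac{|S^{n-2}|}{|S^{n-1}|}\,\frac{1-r^2}{(1+r^2-2rt)^{n/2}},\qquad |r|<1,\ |t|\le 1,\ n\ge 3.$$ The Gegenbauer filtration (operator) $\mathcal{G}_n(r)$ is defined on functions $f$ on $S^{n-1}$ by $$(\mathcal{G}_n(r)f)(\xi)=\frac{1}{|S^{n-2}|}\int_{S^{n-1}}G_n(r,\xi\cdot\eta)f(\eta)\,dS_{n-1}(\eta),\qquad \xi\in S^{n-1},$$ where $\xi\cdot\eta$ is the Euclidean inner product. The hyperspherical Legendre harmonics are the hyperspherical Legendre polynomials $P_{l,n}$, $l=0,1,2,\dots$, where $P_{l,n}$, of degree $l$ in dimension $n$, is $$P_{l,n}(t)=l!\,\Gamma\left(\tfrac{n-1}{2}\right)\sum_{j=0}^{\lfloor l/2\rfloor}(-1)^j\frac{(1-t^2)^j\,t^{l-2j}}{4^j\,j!\,(l-2j)!\,\Gamma\left(j+\tfrac{n-1}{2}\right)},\qquad t\in[-1,1];$$ on the hypersphere they are evaluated at $t=\xi\cdot\eta$ with $\xi,\eta\in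 S^{n-1}$. *)

(* Defs.v *)
From HB Require Import structures.
From mathcomp Require Import all_boot all_order all_algebra.
From mathcomp Require Import all_classical all_reals all_analysis.
From mathcomp Require Import measurable_realfun.

Set Implicit Arguments.
Unset Strict Implicit.
Unset Printing Implicit Defensive.

Import Order.TTheory GRing.Theory Num.Theory.
Import numFieldNormedType.Exports.

Local Open Scope classical_set_scope.
Local Open Scope ring_scope.

Section pushforward_product.
Context d1 d2 d3 (T1 : measurableType d1) (T2 : measurableType d2)
  (T3 : measurableType d3) (R : realType).
Variables (m1 : {sigma_finite_measure set T1 -> \bar R}).
Variables (m2 : {sigma_finite_measure set T2 -> \bar R}).
Variables (f : T1 * T2 -> T3) (g : T3 -> T1 * T2).
Hypotheses (mf : measurable_fun setT f) (mg : measurable_fun setT g).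
Hypothesis fK : cancel f g.

Let push : set T3 -> \bar R := let _ := mf in pushforward (m1 \x m2)%E f.

HB.instance Definition _ := Measure.copy push
  (measure_function_pushforward__canonical__measure_function_Measure
    (m1 \x m2)%E mf).

Let push_sigma_finite : sigma_finite setT push.
Proof.
have /sigma_finiteP[F [TF ndF Foo]] := sigma_finiteT m1.
have /sigma_finiteP[G [TG ndG Goo]] := sigma_finiteT m2.
exists (fun i => g @^-1` (F i `*` G i)).
  apply/esym; rewrite -subTset => z _.
  have [i _ Fi] : (\bigcup_i F i) (g z).1 by rewrite -TF.
  have [j _ Gj] : (\bigcup_i G i) (g z).2 by rewrite -TG.
  exists (maxn i j) => //; split => /=.
    by move: Fi; exact/subsetPset/ndF/leq_maxl.
  by move: Gj; exact/subsetPset/ndG/leq_maxr.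
move=> k; have [mF ?] := Foo k; have [mG ?] := Goo k; split.
  by rewrite -[X in measurable X]setTI; apply: mg => //; exact: measurableX.
rewrite /push /pushforward -comp_preimage (_ : g \o f = id); last first.
  by rewrite funeqE => x /=; rewrite fK.
by rewrite preimage_id product_measure1E// lte_mul_pinfty// ge0_fin_numE.
Qed.

HB.instance Definition _ :=
  Measure_isSigmaFinite.Build _ _ _ push push_sigma_finite.

Lemma pushforward_product_sigma_finite :
  exists m : {sigma_finite_measure set T3 -> \bar R},
    m = pushforward (m1 \x m2)%E f :> (set T3 -> \bar R).
Proof. by exists push. Qed.

End pushforward_product.

(* R^n is n.-tuple R, with the product sigma-algebra that the library puts on
   tuples (generated by the coordinates), i.e. the Borel sets of R^n. *)
Section lebesgue_tuple.
Context {R : realType}.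

Definition tcons n (p : R * n.-tuple R) : n.+1.-tuple R := [tuple of p.1 :: p.2].

Fixpoint lebesgue_tuple n : set (n.-tuple R) -> \bar R :=
  match n with
  | 0 => dirac ([tuple] : 0.-tuple R)
  | m.+1 => pushforward (lebesgue_measure \x @lebesgue_tuple m)%E (@tcons m)
  end.

Lemma measurable_tcons n : measurable_fun setT (@tcons n).
Proof. exact: measurable_cons. Qed.

Lemma lebesgue_tuple_sigma_finite n :
  exists m : {sigma_finite_measure set (n.-tuple R) -> \bar R},
    m = @lebesgue_tuple n :> (set (n.-tuple R) -> \bar R).
Proof.
elim: n => [|n [m IH]].
  by exists (dirac ([tuple] : 0.-tuple R)).
pose g (x : n.+1.-tuple R) : measurableTypeR R * n.-tuple R :=
  (thead x, [tuple of behead x]).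
have mg : measurable_fun setT g.
  apply/measurable_fun_pairP; split; first exact: measurable_tnth.
  exact: measurable_behead.
have fK : cancel (@tcons n) g.
  by move=> [x v]; rewrite /g /tcons theadE; congr pair; exact: val_inj.
have [m' m'E] :=
  pushforward_product_sigma_finite lebesgue_measure m (@measurable_tcons n) mg fK.
by exists m'; rewrite m'E /= -IH.
Qed.

Lemma lebesgue_tuple_ge0 n A : (0 <= @lebesgue_tuple n A)%E.
Proof. by have [m <-] := lebesgue_tuple_sigma_finite n; exact: measure_ge0. Qed.

End lebesgue_tuple.

Section sphere.
Context {R : realType}.
Implicit Type n : nat.

Definition dotp n (x y : n.-tuple R) : R := \sum_(i < n) tnth x i * tnth y i.

(* The unit sphere of R^n, i.e. S^(n-1). *)
Definition sphere n : set (n.-tuple R) := [set x | dotp x x = 1].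

Definition radial n (x : n.-tuple R) : n.-tuple R :=
  [tuple tnth x i / Num.sqrt (dotp x x) | i < n].

(* The cone { s a | 0 < s <= 1, a in A } over a subset A of the sphere. *)
Definition cone n (A : set (n.-tuple R)) : set (n.-tuple R) :=
  [set x | 0 < dotp x x <= 1 /\ A (radial x)].

(* The surface measure dS_(n-1) of the unit sphere of R^n, as a Borel measure
   on R^n carried by the sphere: a cone over A has volume 1/n times the area
   of A, since the sphere of radius s has surface element s^(n-1) dS_(n-1). *)
Definition sphere_measure n (A : set (n.-tuple R)) : \bar R :=
  (n%:R%:E * lebesgue_tuple (cone A))%E.

Lemma measurable_dotp n (f g : n.-tuple R -> n.-tuple R) :
  measurable_fun setT f -> measurable_fun setT g ->
  measurable_fun setT (fun x => dotp (f x) (g x)).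
Proof.
move=> mf mg; apply: measurable_sum => i.
apply: measurable_funM.
  exact: (measurableT_comp (measurable_tnth _) mf).
exact: (measurableT_comp (measurable_tnth _) mg).
Qed.

Lemma measurable_dotpp n :
  measurable_fun setT (fun x : n.-tuple R => dotp x x).
Proof. by apply: (@measurable_dotp n id id); exact: measurable_id. Qed.

Lemma measurable_sphere n : measurable (@sphere n).
Proof.
have -> : @sphere n = setT `&` (fun x => dotp x x) @^-1` [set 1].
  by rewrite setTI.
by apply: measurable_dotpp => //; exact: measurable_set1.
Qed.

Lemma measurable_radial n : measurable_fun setT (@radial n).
Proof.
apply/measurable_fun_tnthP => i.
rewrite (_ : _ \o _ = fun x => tnth x i * (fun t : R => (t `^ (2^-1)) `^ (-1)) (dotp x x)); last first.
  apply/funext => x /=; rewrite tnth_mktuple powR12_sqrt ?powR_inv1 ?sqrtr_ge0//.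
  by apply: sumr_ge0 => j _; rewrite -expr2 sqr_ge0.
apply: measurable_funM; first exact: measurable_tnth.
apply: (@measurableT_comp _ _ _ _ _ _ (fun t : R => (t `^ (2^-1)) `^ (-1))).
  apply: (@measurableT_comp _ _ _ _ _ _ (fun t : R => t `^ (-1))).
    exact: measurable_powR.
  exact: measurable_powR.
exact: measurable_dotpp.
Qed.

Lemma measurable_cone n (A : set (n.-tuple R)) :
  measurable A -> measurable (cone A).
Proof.
move=> mA; have -> : cone A =
    (setT `&` (fun x => dotp x x) @^-1` `]0, 1]) `&` (setT `&` @radial n @^-1` A).
  by rewrite !setTI; apply/seteqP; split => x /=; rewrite in_itv.
apply: measurableI; last exact: measurable_radial.
by apply: measurable_dotpp.
Qed.

Section sphere_measure_is_measure.
Variable n : nat.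

Let sphere_measure0 : @sphere_measure n set0 = 0%E.
Proof.
rewrite /sphere_measure (_ : cone _ = set0); last by apply/seteqP; split => x // [].
by have [m <-] := @lebesgue_tuple_sigma_finite R n; rewrite measure0 mule0.
Qed.

Let sphere_measure_ge0 A : (0 <= @sphere_measure n A)%E.
Proof. by rewrite mule_ge0// ?lee_fin// lebesgue_tuple_ge0. Qed.

Let sphere_measure_sigma_additive : semi_sigma_additive (@sphere_measure n).
Proof.
move=> F mF tF mUF.
have coneU : cone (\bigcup_i F i) = \bigcup_i cone (F i).
  apply/seteqP; split => x; first by move=> [x1 [i _ Fi]]; exists i.
  by move=> [i _ [x1 Fi]]; split => //; exists i.
rewrite /sphere_measure coneU.
rewrite (_ : (fun k => _) = (fun k =>
    n%:R%:E * \sum_(0 <= i < k) lebesgue_tuple (cone (F i)))%E); last first.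
  by apply/funext => k; rewrite ge0_sume_distrr// => *; exact: lebesgue_tuple_ge0.
apply: cvgeZl => //.
have [m <-] := @lebesgue_tuple_sigma_finite R n.
apply: measure_semi_sigma_additive.
- by move=> i; exact: measurable_cone.
- apply/trivIsetP => i j _ _ ij; apply/seteqP; split => x // [[_ Fi] [_ Fj]].
  move/trivIsetP : tF => /(_ i j Logic.I Logic.I ij) F0.
  suff : set0 (radial x) by [].
  by rewrite -F0.
- by rewrite -coneU; exact: measurable_cone.
Qed.

HB.instance Definition _ := isMeasure.Build _ _ _ (@sphere_measure n)
  sphere_measure0 sphere_measure_ge0 sphere_measure_sigma_additive.

End sphere_measure_is_measure.

(* The surface area of the unit sphere of R^n: |S^(n-1)| is [sphere_area n] and
   |S^(n-2)| is [sphere_area n.-1]. *)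
Definition sphere_area n : R := \int[@sphere_measure n]_(x in @sphere n) 1.

End sphere.

Section gegenbauer.
Context {R : realType}.
Implicit Types (n l : nat) (r t : R).

Definition Gamma (x : R) : R :=
  \int[lebesgue_measure]_(t in `]0%R, +oo[) (t `^ (x - 1) * expR (- t)).

Definition legendre n l t : R :=
  l`!%:R * Gamma ((n%:R - 1) / 2) *
  \sum_(j < l./2.+1)
    (-1) ^+ j * ((1 - t ^+ 2) ^+ j * t ^+ (l - j.*2) /
      (4 ^+ j * j`!%:R * (l - j.*2)`!%:R * Gamma (j%:R + (n%:R - 1) / 2))).

Definition gegenbauer_kernel n r t : R :=
  @sphere_area R n.-1 / @sphere_area R n *
  ((1 - r ^+ 2) / (1 + r ^+ 2 - 2 * r * t) `^ (n%:R / 2)).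

Definition zonal_operator n (K : R -> R) (f : n.-tuple R -> R)
    (xi : n.-tuple R) : R :=
  (@sphere_area R n.-1)^-1 *
  \int[@sphere_measure R n]_(eta in @sphere R n) (K (dotp xi eta) * f eta).

Definition gegenbauer_filtration n r : (n.-tuple R -> R) -> n.-tuple R -> R :=
  zonal_operator (gegenbauer_kernel n r).

(* Convergence, in operator norm, of operators from L^1 of the sphere to the
   bounded functions on the sphere. The sphere has finite area, so this implies
   norm convergence on the continuous functions and on every L^p. *)
Definition operator_limit n (T : nat -> (n.-tuple R -> R) -> n.-tuple R -> R)
    (G : (n.-tuple R -> R) -> n.-tuple R -> R) : Prop :=
  forall e : R, 0 < e -> \forall k \near \oo,
    forall f : n.-tuple R -> R,
      (@sphere_measure R n).-integrable (@sphere R n) (EFin \o f) ->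
      forall xi, @sphere R n xi ->
        `|T k f xi - G f xi|
          <= e * \int[@sphere_measure R n]_(eta in @sphere R n) `|f eta|.

End gegenbauer.

(* Main.v *)
Require Import Defs.
From mathcomp Require Import all_boot all_order all_algebra.
From mathcomp Require Import all_classical all_reals all_analysis.
From mathcomp Require Import measurable_realfun.
From mathcomp Require Import ring lra.
Import Order.TTheory GRing.Theory Num.Theory.
Import numFieldNormedType.Exports.
Local Open Scope classical_set_scope.
Local Open Scope ring_scope.

(** The coefficients of the k-th linear combination may depend on k, so no
    expansion in Legendre polynomials has to converge: it is enough that finite
    combinations of them come uniformly close to the kernel on [[-1, 1]].

    Since [|r| < 1], the quantity [1 + r^2 - 2 r t] stays positive for [|t| <= 1]
    and the kernel is continuous there ([continuous_gegenbauer_kernel]). By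
    Weierstrass ([weierstrass_approximation], proved with Bernstein polynomials)
    it is a uniform limit of polynomials. The hyperspherical Legendre polynomial
    of index [l] has degree exactly [l] ([size_legendre_poly]): its leading
    coefficient is a sum of positive terms, because the Gamma values in it are
    positive ([Gamma_gt0]). Hence these polynomials form a basis of all
    polynomials ([staggered_poly_span]), and the Weierstrass approximants are
    finite combinations of them.

    By Cauchy-Schwarz, inner products of unit vectors lie in [[-1, 1]], so the
    approximation of the kernels is uniform on pairs of points of the sphere. It
    passes to the operators since a zonal operator depends linearly on its kernel
    ([zonal_operator_sum]), and moving the kernel by at most [d] on [[-1, 1]]
    moves the image of [f] by at most a constant times [d] times the L^1 norm
    of [f] ([zonal_operator_dist]). *)

Set Implicit Arguments.
Unset Strict Implicit.
Unset Printing Implicit Defensive.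

(** * Weierstrass approximation on a segment *)

Lemma bounded_within_compact (R : realType) (K : set R) (f : R -> R) :
  compact K -> {within K, continuous f} ->
  exists2 M, 0 <= M & forall x, K x -> `|f x| <= M.
Proof.
move=> cK cf; have [M0 [_ hM]] := compact_bounded (continuous_compact cf cK).
exists (`|M0| + 1); first by rewrite addr_ge0.
move=> x Kx; apply: hM; last by exists x.
by rewrite (le_lt_trans (ler_norm _))// ltrDl.
Qed.

(** A form of uniform continuity suited to Bernstein polynomials: near the
    diagonal the oscillation is at most [e], and away from it the quadratic term
    dominates the total oscillation of [f]. Compactness makes [C] uniform. *)
Lemma quadratic_modulus (R : realType) (K : set R) (f : R -> R) (e : R) :
  compact K -> {within K, continuous f} -> 0 < e ->
  exists2 C, 0 <= C & forall x y, K x -> K y ->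
    `|f x - f y| <= e + C * (x - y) ^+ 2.
Proof.
move=> cK cf e0; have [M M0 hM] := bounded_within_compact cK cf.
pose P C x := 0 <= C /\ (K x -> forall y, K y ->
  `|f x - f y| <= e + C * (x - y) ^+ 2).
have : \forall C \near +oo, K `<=` P C.
  move/compact_near_coveringP : cK; apply => x0 Kx0.
  have /subspace_continuousP /(_ _ Kx0) cfx := cf.
  have e20 : 0 < e / 2 by rewrite divr_gt0.
  have /cvgr_dist_lt/(_ _ e20) := cfx.
  rewrite near_withinE => /nbhs_ballP[d /= d0 hd].
  have d20 : 0 < d / 2 by rewrite divr_gt0.
  near=> x C => /=.
  have C0 : 0 <= C by near: C; exact: nbhs_pinfty_ge.
  split=> // Kx y Ky.
  have xd : `|x0 - x| < d / 2 by near: x; exact: (nbhsx_ballx x0 _ d20).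
  have CM : 2 * M / (d / 2) ^+ 2 <= C.
    by near: C; apply: nbhs_pinfty_ge; exact: num_real.
  have fx : `|f x0 - f x| < e / 2.
    apply: hd => //=; apply: lt_trans xd _.
    by rewrite ltr_pdivrMr// ltr_pMr// ltr1n.
  (* either y is close to x0, as x is, or x and y are at least d / 2 apart *)
  have [yd|yd] := ltP `|x0 - y| d.
    have fy : `|f x0 - f y| < e / 2 by apply: hd.
    have fxy : `|f x - f y| <= e.
      rewrite (_ : f x - f y = (f x0 - f y) - (f x0 - f x)); last by ring.
      by rewrite (le_trans (ler_normB _ _))// [e]splitr lerD ?ltW.
    by rewrite (le_trans fxy)// lerDl mulr_ge0 ?sqr_ge0.
  have xy : d / 2 <= `|x - y|.
    rewrite -(lerD2l (d / 2)) -splitr (le_trans yd)//.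
    by rewrite (le_trans (ler_distD x _ _))// lerD2r ltW.
  rewrite (le_trans (ler_normB _ _))// (le_trans (lerD (hM _ Kx) (hM _ Ky)))//.
  rewrite ler_wpDl ?(ltW e0)//.
  move: CM; rewrite ler_pdivrMr ?exprn_gt0// => CM.
  rewrite (_ : M + M = 2 * M); last by ring.
  apply: le_trans CM _; rewrite ler_wpM2l//.
  by rewrite -(real_normK (num_real (x - y))) lerXn2r// ?nnegrE// ltW.
move=> hC; have [C [C0 hC']] : exists C, 0 <= C /\ K `<=` P C.
  near +oo_R => C; exists C; split; near: C => //.
  exact: nbhs_pinfty_ge.
by exists C => // x y Kx Ky; have [_] := hC' x Kx; exact.
Unshelve. all: by end_near. Qed.

(** The Bernstein polynomial of order [n] of the samples [phi 0, ..., phi n],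
    defined by the De Casteljau recursion: this makes positivity and the two
    moments needed below immediate inductions, without binomial sums. *)
Fixpoint bernstein (R : comNzRingType) n (phi : nat -> R) : {poly R} :=
  if n is m.+1 then
    (1 - 'X) * bernstein m phi + 'X * bernstein m (fun k => phi k.+1)
  else (phi 0)%:P.

Lemma bernsteinS (R : comNzRingType) n (phi : nat -> R) x :
  (bernstein n.+1 phi).[x] =
  (1 - x) * (bernstein n phi).[x] + x * (bernstein n (fun k => phi k.+1)).[x].
Proof. by rewrite /= !hornerE. Qed.

Lemma bernstein_le (R : realFieldType) n (phi psi : nat -> R) x : 0 <= x <= 1 ->
  (forall k, (k <= n)%N -> phi k <= psi k) ->
  (bernstein n phi).[x] <= (bernstein n psi).[x].
Proof.
move=> x01; elim: n phi psi => [|n IH] phi psi le_phi.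
  by rewrite /= !hornerE le_phi.
have /andP[x0 x1] := x01.
rewrite !bernsteinS lerD// ler_wpM2l ?subr_ge0//; apply: IH => k kn.
  by apply: le_phi; exact: leqW.
exact: le_phi.
Qed.

(** Mean and variance of the binomial law, in the form preserved by the
    recursion: passing from [n] to [n.+1] replaces [y] by [y - 1] in the second
    branch. *)
Lemma bernstein_quadratic (R : comNzRingType) n (A B y x : R) :
  (bernstein n (fun k => A + B * (k%:R - y) ^+ 2)).[x] =
  A + B * ((n%:R * x - y) ^+ 2 + n%:R * (x * (1 - x))).
Proof.
elim: n y => [|n IH] y; first by rewrite /= !hornerE /=; ring.
rewrite bernsteinS IH.
rewrite (_ : (fun k => _) = (fun k => A + B * (k%:R - (y - 1)) ^+ 2)); last first.
  by apply/funext => k; rewrite -natr1; congr (_ + _ * _ ^+ 2); ring.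
by rewrite IH -natr1; ring.
Qed.

(** A quadratic bound on the oscillation of [g] is transferred to its Bernstein
    polynomials by positivity, with the variance [x (1 - x) / n] in place of the
    square. *)
Lemma bernstein_approx (R : realFieldType) n (g : R -> R) (e C x : R) :
  (0 < n)%N -> 0 <= x <= 1 -> 0 <= C ->
  (forall y, 0 <= y <= 1 -> `|g y - g x| <= e + C * (y - x) ^+ 2) ->
  `|g x - (bernstein n (fun k => g (k%:R / n%:R))).[x]| <= e + C / n%:R.
Proof.
move=> n0 x01 C0 hg; have /andP[x0 x1] := x01.
have n0R : 0 < n%:R :> R by rewrite ltr0n.
have gk k : (k <= n)%N ->
    `|g (k%:R / n%:R) - g x| <= e + C / n%:R ^+ 2 * (k%:R - n%:R * x) ^+ 2.
  move=> kn; rewrite (_ : e + _ = e + C * (k%:R / n%:R - x) ^+ 2); last first.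
    by field; rewrite gt_eqF.
  by apply: hg; rewrite divr_ge0//= ler_pdivrMr// mul1r ler_nat.
have xx1 : x * (1 - x) <= 1.
  rewrite -[leRHS]mulr1 ler_pM// ?subr_ge0//; lra.
have err : C / n%:R ^+ 2 * (n%:R * (x * (1 - x))) <= C / n%:R.
  rewrite (_ : _ * _ = C / n%:R * (x * (1 - x))); last by field; rewrite gt_eqF.
  by rewrite ler_piMr// divr_ge0// ltW.
have up : (bernstein n (fun k => g (k%:R / n%:R))).[x] <=
    (bernstein n (fun k => (g x + e) + C / n%:R ^+ 2 * (k%:R - n%:R * x) ^+ 2)).[x].
  apply: bernstein_le => // k /gk; rewrite ler_norml; lra.
have lo : (bernstein n (fun k => (g x - e) + - (C / n%:R ^+ 2) * (k%:R - n%:R * x) ^+ 2)).[x]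
    <= (bernstein n (fun k => g (k%:R / n%:R))).[x].
  apply: bernstein_le => // k /gk; rewrite ler_norml; lra.
move: up lo; rewrite !bernstein_quadratic subrr expr0n/= !add0r mulNr ler_norml.
by move: err; set v := C / n%:R ^+ 2 * _ => err up lo; apply/andP; split; lra.
Qed.

(** The Bernstein polynomials on [[0, 1]], transported to [[a, b]] by an affine
    change of variable. *)
Lemma weierstrass_approximation (R : realType) (a b : R) (f : R -> R) (e : R) :
  a < b -> {within `[a, b], continuous f} -> 0 < e ->
  exists p : {poly R}, forall x, a <= x <= b -> `|f x - p.[x]| < e.
Proof.
move=> ab cf e0; have e20 : 0 < e / 2 by rewrite divr_gt0.
have [C C0 hC] := quadratic_modulus (@segment_compact R a b) cf e20.
have ba : 0 < b - a by rewrite subr_gt0.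
pose D := C * (b - a) ^+ 2.
pose g s := f (a + (b - a) * s).
have D0 : 0 <= D by rewrite mulr_ge0 ?sqr_ge0.
have [n n0 hn] : exists2 n, (0 < n)%N & D / n%:R < e / 2.
  exists (Num.bound (2 * D / e)).+1 => //; rewrite ltr_pdivrMr//.
  have := archi_boundP (divr_ge0 (mulr_ge0 (ler0n _ 2) D0) (ltW e0)).
  rewrite ltr_pdivrMr//; set N := Num.bound _ => hN.
  by apply: (@lt_le_trans _ _ (e / 2 * N%:R)); [lra | rewrite ler_pM2l// ler_nat].
exists (bernstein n (fun k => g (k%:R / n%:R)) \Po
  ((b - a)^-1 *: ('X - a%:P))) => x /andP[ax xb].
set s := (x - a) / (b - a).
have s01 : 0 <= s <= 1.
  by rewrite divr_ge0 ?subr_ge0 ?(ltW ab)//= ler_pdivrMr// mul1r lerD2r.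
have in_ab u : 0 <= u <= 1 -> `[a, b]%classic (a + (b - a) * u).
  by move=> /andP[u0 u1] /=; rewrite in_itv/=; apply/andP; split; nra.
have -> : f x = g s by rewrite /g; congr f; rewrite /s; field; rewrite gt_eqF.
rewrite horner_comp !hornerE (_ : (b - a)^-1 * _ = s); last exact: mulrC.
apply: (@le_lt_trans _ _ (e / 2 + D / n%:R)); last by lra.
apply: bernstein_approx => // y y01.
have := hC _ _ (in_ab _ y01) (in_ab _ s01).
by rewrite (_ : C * _ = D * (y - s) ^+ 2)//; rewrite /D; ring.
Qed.

(** * The Gamma function *)

(** On [t > 0], [t `^ y * expR (- t)] is dominated by a multiple of the
    exponential density of rate [1 / (y + 1)], because [t / (y + 1) <=
    expR (t / (y + 1))]. *)
Lemma Gamma_integrand_le (R : realType) (y t : R) : 0 <= y -> 0 < t ->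
  t `^ y * expR (- t) <=
  (y + 1) `^ y * (y + 1) * exponential_pdf (y + 1)^-1 t.
Proof.
move=> y0 t0; have y1 : 0 < y + 1 by rewrite ltr_wpDl.
rewrite exponential_pdfE ?(ltW t0)//.
rewrite [leRHS](_ : _ = (y + 1) `^ y * expR (- (y + 1)^-1 * t)); last first.
  by field; rewrite gt_eqF.
have le_t : t <= (y + 1) * expR (t / (y + 1)).
  rewrite mulrC -ler_pdivrMr//.
  by apply: le_trans (expR_ge1Dx _); rewrite lerDr.
have := ge0_ler_powR y0 _ _ le_t.
rewrite !nnegrE (ltW t0) mulr_ge0 ?expR_ge0 ?(ltW y1)// => /(_ isT isT).
rewrite powRM ?expR_ge0 ?(ltW y1)// -expRM => le_ty.
rewrite (_ : - (y + 1)^-1 * t = t / (y + 1) * y + - t); last first.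
  by field; rewrite gt_eqF.
by rewrite expRD mulrA ler_wpM2r ?expR_ge0.
Qed.

Lemma measurable_Gamma_integrand (R : realType) (x : R) :
  measurable_fun [set: R] (fun t => t `^ (x - 1) * expR (- t)).
Proof.
apply: measurable_funM; first exact: measurable_powR.
by apply: measurableT_comp => //; exact: measurable_expR.
Qed.

Lemma integrable_Gamma_integrand (R : realType) (x : R) : 1 <= x ->
  lebesgue_measure.-integrable `]0%R, +oo[
    (EFin \o (fun t => t `^ (x - 1) * expR (- t))).
Proof.
move=> x1; have y0 : 0 <= x - 1 by rewrite subr_ge0.
have r0 : 0 < (x - 1 + 1)^-1 by rewrite invr_gt0 ltr_wpDl.
pose c := (x - 1 + 1) `^ (x - 1) * (x - 1 + 1).
have pdf_int : lebesgue_measure.-integrable `]0%R, +oo[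
    (EFin \o exponential_pdf (x - 1 + 1)^-1).
  by apply: (integrableS measurableT) => //; exact: integrable_exponential_pdf.
apply: le_integrable (integrableZl _ c pdf_int) => //.
- apply/measurable_EFinP; apply: measurable_funTS.
  exact: measurable_Gamma_integrand.
- move=> t /=; rewrite in_itv/= andbT => t0.
  rewrite lee_fin ger0_norm ?mulr_ge0 ?powR_ge0 ?expR_ge0//.
  by apply: le_trans (ler_norm _); exact: Gamma_integrand_le.
Qed.

(** [Gamma] is a real-valued integral, which would be 0 by convention if the
    integral diverged; positivity therefore needs the domination above. The lower
    bound comes from [[1, 2]], where the integrand is at least [expR (- 2)]. *)
Lemma Gamma_gt0 (R : realType) (x : R) : 1 <= x -> 0 < Gamma x.
Proof.
move=> x1; have [mf foo] := integrableP _ _ _ (integrable_Gamma_integrand x1).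
have f0 t : 0 <= t `^ (x - 1) * expR (- t) by rewrite mulr_ge0 ?powR_ge0 ?expR_ge0.
apply: fine_gt0; apply/andP; split; last first.
  by under eq_integral do rewrite -[X in X%:E]ger0_norm ?f0//.
apply: (@lt_le_trans _ _ (\int[lebesgue_measure]_(t in `[1%R, 2%R])
    (t `^ (x - 1) * expR (- t))%:E)%E); last first.
  apply: ge0_subset_integral => //.
    by move=> t _; rewrite lee_fin.
  by apply: subset_itv; rewrite bnd_simp.
apply: (@lt_le_trans _ _ (\int[lebesgue_measure]_(t in `[1%R, 2%R])
    (expR (- 2))%:E)%E).
  rewrite integral_cst//= lebesgue_measure_itv/= lte_fin ltr1n.
  by rewrite -EFinD -EFinM lte_fin mulr_gt0 ?expR_gt0//; lra.
apply: ge0_le_integral => //.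
- apply/measurable_EFinP; apply: measurable_funTS.
  exact: measurable_Gamma_integrand.
- move=> t /=; rewrite in_itv/= => /andP[t1 t2]; rewrite lee_fin.
  rewrite -[leLHS]mul1r ler_pM ?expR_ge0 ?ler_expR ?lerN2//.
  rewrite [leLHS](_ : 1 = 1 `^ (x - 1)); last by rewrite powR1.
  rewrite ge0_ler_powR ?nnegrE ?subr_ge0//.
  exact: le_trans t1.
Qed.

(** * The Legendre polynomials span all polynomials *)

Lemma staggered_poly_span (F : fieldType) (P : nat -> {poly F}) :
  (forall l, size (P l) = l.+1) ->
  forall m (q : {poly F}), (size q <= m)%N ->
    exists c : nat -> F, q = \sum_(l < m) c l *: P l.
Proof.
move=> sP; elim=> [|m IH] p sp.
  by exists (fun=> 0); rewrite big_ord0; apply/eqP; rewrite -size_poly_leq0.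
have lcP : (P m)`_m != 0.
  rewrite -[m in _`_m]/(m.+1.-1) -(sP m) -lead_coefE lead_coef_eq0.
  by rewrite -size_poly_gt0 sP.
(* eliminating the top coefficient of p against that of P m lowers the size *)
pose a := p`_m / (P m)`_m.
have [|c cE] := IH (p - a *: P m).
  apply/leq_sizeP => i; rewrite leq_eqVlt => /predU1P[<-|mi].
    by rewrite coefB coefZ divfK// subrr.
  rewrite coefB coefZ !nth_default ?mulr0 ?subr0// ?sP//.
  exact: leq_trans mi.
exists (fun l => if l == m then a else c l).
rewrite big_ord_recr/= eqxx (eq_bigr (fun l : 'I_m => c l *: P l)) -?cE ?subrK//.
by move=> i _; rewrite ltn_eqF.
Qed.

Section legendre_polynomial.
Variables (R : realType) (n : nat).

Definition legendre_poly l : {poly R} :=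
  (l`!%:R * Gamma ((n%:R - 1) / 2 : R)) *:
  \sum_(j < l./2.+1) ((-1) ^+ j /
      (4 ^+ j * j`!%:R * (l - j.*2)`!%:R * Gamma (j%:R + (n%:R - 1) / 2))) *:
    ((1 - 'X^2) ^+ j * 'X^(l - j.*2)).

Lemma horner_legendre_poly l t : (legendre_poly l).[t] = legendre n l t.
Proof.
rewrite /legendre_poly hornerZ horner_sum /legendre; congr (_ * _).
by apply: eq_bigr => j _; rewrite !hornerE/= -!mulrA; congr (_ * _); rewrite [RHS]mulrA [RHS]mulrC.
Qed.

(** The signs [(-1) ^+ j] cancel against those of the leading terms of
    [(1 - t^2) ^+ j], so that [t ^+ l] gets a sum of positive coefficients. *)
Lemma size_legendre_poly l : (3 <= n)%N -> size (legendre_poly l) = l.+1.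
Proof.
move=> n3.
have n1 : 1 <= (n%:R - 1) / 2 :> R.
  by rewrite ler_pdivlMr// mul1r lerBrDr (_ : 2 + 1 = 3%:R) ?ler_nat//; ring.
pose q (j : nat) : {poly R} := ('X^2 - 1) ^+ j * 'X^(l - j.*2).
have e_monic (j : nat) : ('X^2 - 1 : {poly R}) ^+ j \is monic.
  by apply: monic_exp; exact: monic_Xn_sub_1.
have q_monic j : q j \is monic.
  by rewrite /q monicMl ?monicXn// e_monic.
have jl (j : 'I_l./2.+1) : (j.*2 <= l)%N.
  by rewrite -geq_half_double -ltnS.
have sq (j : 'I_l./2.+1) : size (q j) = l.+1.
  rewrite size_monicM ?e_monic ?monic_neq0 ?monicXn//.
  rewrite size_polyXn addnS/= -[size _]prednK ?size_poly_gt0 ?monic_neq0//.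
  by rewrite size_exp size_Xn_sub_1//= mul2n addSn subnKC.
have lq (j : 'I_l./2.+1) : (q j)`_l = 1.
  by rewrite -[l in _`_l]/(l.+1.-1) -(sq j) -lead_coefE (eqP (q_monic j)).
pose d (j : nat) : R :=
  (4 ^+ j * j`!%:R * (l - j.*2)`!%:R * Gamma (j%:R + (n%:R - 1) / 2))^-1.
have d_gt0 j : 0 < d j.
  rewrite invr_gt0 !mulr_gt0 ?exprn_gt0 ?ltr0n ?fact_gt0// Gamma_gt0//.
  by rewrite ler_wpDl.
have qE : legendre_poly l = (l`!%:R * Gamma ((n%:R - 1) / 2)) *:
    \sum_(j < l./2.+1) d j *: q j.
  congr (_ *: _); apply: eq_bigr => j _.
  have -> : (1 - 'X^2 : {poly R}) ^+ j = (-1) ^+ odd j * ('X^2 - 1) ^+ j.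
    by rewrite signr_odd -exprNn opprB.
  rewrite -[_ * _ * 'X^_]mulrA -/(q j) -(signr_odd R j).
  by case: odd; rewrite ?expr1 ?expr0 ?mul1r// !mulN1r scaleNr scalerN opprK.
rewrite qE size_scale ?mulf_neq0 ?pnatr_eq0 -?lt0n ?fact_gt0 ?gt_eqF ?Gamma_gt0//.
apply/eqP; rewrite eqn_leq; apply/andP; split.
  apply: (leq_trans (size_sum _ _ _)); apply/bigmax_leqP => j _.
  by rewrite (leq_trans (size_scale_leq _ _))// sq.
rewrite ltnNge; apply/negP => sl.
have : (\sum_(j < l./2.+1) d j *: q j)`_l = 0 by rewrite nth_default.
apply/eqP; rewrite coef_sum gt_eqF// big_ord_recl/= ltr_pwDl//.
  by rewrite coefZ (lq ord0) mulr1.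
by apply: sumr_ge0 => j _; rewrite coefZ (lq (lift ord0 j)) mulr1 ltW.
Qed.

End legendre_polynomial.

(** * Zonal operators with a continuous kernel *)

(** Cauchy-Schwarz for unit vectors, by expanding the squared norm of [x + s y]
    for [s = 1] and [s = - 1]. *)
Lemma dotp_sphere_itv (R : realType) n (x y : n.-tuple R) :
  sphere x -> sphere y -> `[-1, 1]%classic (dotp x y).
Proof.
rewrite /sphere/= => x1 y1; rewrite in_itv/=.
have half s : s ^+ 2 = 1 -> 0 <= 1 + 1 + 2 * (s * dotp x y).
  move=> s1; rewrite -{1}x1 -{1}y1 /dotp mulr_sumr mulr_sumr -!big_split/=.
  apply: sumr_ge0 => i _.
  rewrite (_ : _ + _ = (tnth x i + s * tnth y i) ^+ 2) ?sqr_ge0//.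
  by rewrite sqrrD exprMn s1 mul1r; ring.
have := half 1; have := half (-1); rewrite sqrrN expr1n => /(_ erefl) ? /(_ erefl) ?.
by apply/andP; split; lra.
Qed.

Lemma within_continuous_sum (R : realType) (A : set R) (c : nat -> R)
    (P : nat -> R -> R) N : (forall l, {within A, continuous (P l)}) ->
  {within A, continuous (fun t => \sum_(l < N) c l * P l t)}.
Proof.
move=> cP; elim: N => [|N IH] x.
  by under [X in continuous_at _ X]eq_fun do rewrite big_ord0; exact: cst_continuous.
under [X in continuous_at _ X]eq_fun do rewrite big_ord_recr/=.
by apply: cvgD; [exact: IH | apply: cvgM; [exact: cvg_cst | exact: cP]].
Qed.

Section zonal.
Variables (R : realType) (n : nat).
Implicit Types (K : R -> R) (f : n.-tuple R -> R).
Local Notation sigma := (@sphere_measure R n).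

(** The kernel is bounded on the values of the inner product, so multiplying by
    it preserves integrability. *)
Lemma zonal_integrable K f xi :
  {within `[-1, 1], continuous K} -> sphere xi ->
  sigma.-integrable (@sphere R n) (EFin \o f) ->
  sigma.-integrable (@sphere R n)
    (EFin \o (fun eta => K (dotp xi eta) * f eta)).
Proof.
move=> cK xi1 intf; have mS := @measurable_sphere R n.
have [M M0 hM] := bounded_within_compact (@segment_compact R (-1) 1) cK.
have mK : measurable_fun (@sphere R n) (K \o dotp xi).
  apply: measurable_comp (subspace_continuous_measurable_fun _ cK) _ => //.
  - by move=> _ [eta eta1 <-]; exact: dotp_sphere_itv.
  - by apply: measurable_funTS; apply: measurable_dotp => //; exact: measurable_cst.
apply: (integrableMr mS (h := K \o dotp xi)) intf => //.
exists M; split; first exact: num_real.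
move=> M' /ltW MM' eta eta1; apply: le_trans MM'.
by apply: hM; exact: dotp_sphere_itv.
Qed.

Lemma zonal_operator_sum N (c : nat -> R) (P : nat -> R -> R) f xi :
  (forall l, {within `[-1, 1], continuous (P l)}) -> sphere xi ->
  sigma.-integrable (@sphere R n) (EFin \o f) ->
  \sum_(l < N) c l * zonal_operator (P l) f xi =
  zonal_operator (fun t => \sum_(l < N) c l * P l t) f xi.
Proof.
move=> cP xi1 intf; have mS := @measurable_sphere R n.
elim: N => [|N IH].
  rewrite big_ord0 /zonal_operator.
  under eq_Rintegral do rewrite big_ord0 mul0r.
  by rewrite Rintegral_cst// mul0r mulr0.
rewrite big_ord_recr/= IH /zonal_operator mulrCA -mulrDr; congr (_ * _).
have I1 := zonal_integrable (@within_continuous_sum _ _ c _ N cP) xi1 intf.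
have I2 := zonal_integrable (cP N) xi1 intf.
rewrite -RintegralZl// -RintegralD//; last exact: (integrableZl mS _ I2).
by apply: eq_Rintegral => eta _; rewrite big_ord_recr/= mulrDl mulrA.
Qed.

(** The integral of [`|f|] absorbs the uniform distance of the kernels on
    [[-1, 1]], where all inner products of unit vectors lie. *)
Lemma zonal_operator_dist K K' f d xi :
  {within `[-1, 1], continuous K} -> {within `[-1, 1], continuous K'} ->
  (forall t, -1 <= t <= 1 -> `|K t - K' t| <= d) -> sphere xi ->
  sigma.-integrable (@sphere R n) (EFin \o f) ->
  `|zonal_operator K f xi - zonal_operator K' f xi| <=
    `|(@sphere_area R n.-1)^-1| * d * \int[sigma]_(eta in @sphere R n) `|f eta|.
Proof.
move=> cK cK' hd xi1 intf; have mS := @measurable_sphere R n.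
have I1 := zonal_integrable cK xi1 intf.
have I2 := zonal_integrable cK' xi1 intf.
have If := integrable_norm intf.
rewrite /zonal_operator -mulrBr normrM -mulrA ler_wpM2l// -RintegralB//.
have I12 := integrableB mS I1 I2.
rewrite (le_trans (le_normr_Rintegral mS I12))// -RintegralZl//.
apply: le_Rintegral => //.
- exact: (integrable_norm I12).
- exact: (integrableZl mS _ If).
move=> eta eta1; rewrite -mulrBl normrM ler_wpM2r// hd//.
by have := dotp_sphere_itv xi1 eta1; rewrite /= in_itv.
Qed.

End zonal.

(** * The Gegenbauer kernel *)

(** The denominator is at least [(1 - |r|)^2 > 0] on [[-1, 1]]. *)
Lemma continuous_gegenbauer_kernel (R : realType) n (r : R) : `|r| < 1 ->
  {within `[-1, 1], continuous (gegenbauer_kernel n r)}.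
Proof.
move=> r1; apply: continuous_in_subspaceT => t; rewrite inE/= in_itv/= => /andP[t1 t2].
have q0 : 0 < 1 + r ^+ 2 - 2 * r * t.
  have : r * t <= `|r|.
    rewrite (le_trans (ler_norm _))// normrM ler_piMr// ler_norml.
    by apply/andP.
  by rewrite -(real_normK (num_real r)); nra.
rewrite /gegenbauer_kernel.
apply: cvgM; first exact: cvg_cst.
apply: cvgM; first exact: cvg_cst.
apply: cvgV; first by rewrite gt_eqF// powR_gt0.
apply: (@continuous_comp _ _ _ (fun s : R => 1 + r ^+ 2 - 2 * r * s)
  (fun u : R => u `^ (n%:R / 2))).
  apply: cvgB; first exact: cvg_cst.
  by apply: cvgM; [exact: cvg_cst | exact: cvg_id].
apply: differentiable_continuous; apply/derivable1_diffP.
by apply: derivable_powR; rewrite in_itv/= q0.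
Qed.

Lemma gegenbauer_kernel_approx (R : realType) n (r e : R) :
  (3 <= n)%N -> `|r| < 1 -> 0 < e ->
  exists (N : nat) (c : nat -> R), forall t, -1 <= t <= 1 ->
    `|gegenbauer_kernel n r t - \sum_(l < N) c l * legendre n l t| < e.
Proof.
move=> n3 r1 e0.
have [|p hp] := weierstrass_approximation _ (continuous_gegenbauer_kernel (n := n) r1) e0.
  by lra.
have [c cE] := staggered_poly_span (fun l => @size_legendre_poly R n l n3) (leqnn (size p)).
exists (size p), c => t /hp; rewrite {1}cE horner_sum.
by under eq_bigr do rewrite hornerZ horner_legendre_poly.
Qed.

Theorem theorem4p3 (R : realType) (n : nat) (r : R)
    (hn : (3 <= n)%N) (hr : `|r| < 1) :
  exists (N : nat -> nat) (c : nat -> nat -> R),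
    {uniform (@sphere R n `*` @sphere R n),
      (fun k (p : n.-tuple R * n.-tuple R) =>
         \sum_(l < N k) c k l * legendre n l (dotp p.1 p.2)) @ \oo -->
      (fun p : n.-tuple R * n.-tuple R =>
         gegenbauer_kernel n r (dotp p.1 p.2))} /\
    operator_limit
      (fun k f xi =>
         \sum_(l < N k) c k l * zonal_operator (legendre n l) f xi)
      (@gegenbauer_filtration R n r).
Proof.
have /choice[N /choice[c hc]] : forall k : nat, exists (N : nat) (c : nat -> R),
    forall t : R, -1 <= t <= 1 ->
    `|gegenbauer_kernel n r t - \sum_(l < N) c l * legendre n l t| < k.+1%:R^-1.
  by move=> k; apply: gegenbauer_kernel_approx => //; rewrite invr_gt0.
exists N, c; split.
  move=> P /uniform_nbhs[E [entE subP]].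
  move: entE; rewrite -entourage_ballE => -[e /= e0 ballE].
  have := near_infty_natSinv_lt (PosNum e0); apply: filterS => k /= ke.
  apply: subP => -[x y] [/= x1 y1]; apply: ballE => /=.
  rewrite /ball/= (lt_trans (hc _ _ _))//.
  by have := dotp_sphere_itv x1 y1; rewrite /= in_itv.
have legendre_cont l : {within `[-1, 1], continuous (@legendre R n l)}.
  apply: continuous_subspaceT.
  rewrite (_ : legendre n l = horner (legendre_poly R n l)).
    exact: continuous_horner.
  by apply/funext => t; rewrite horner_legendre_poly.
(* a + 1 instead of a, to have a nonzero denominator *)
move=> e e0; pose a := `|(@sphere_area R n.-1)^-1|.
have a0 : 0 <= a by exact: normr_ge0.
have e1 : 0 < e / (a + 1) by rewrite divr_gt0// ltr_wpDl.
have := near_infty_natSinv_lt (PosNum e1); apply: filterS => k /= ke f intf xi xi1.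
rewrite zonal_operator_sum// distrC.
apply: (le_trans (zonal_operator_dist (d := k.+1%:R^-1) _ _ _ xi1 intf)).
- exact: continuous_gegenbauer_kernel.
- exact: within_continuous_sum.
- by move=> t /hc /ltW.
- rewrite ler_wpM2r ?Rintegral_ge0// -/a.
  move: ke; rewrite ltr_pdivlMr ?ltr_wpDl// => ke.
  have : 0 < k.+1%:R^-1 :> R by rewrite invr_gt0.
  by move: ke; set v := k.+1%:R^-1; nra.
Qed.
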